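(* Let $\Pi$ be a point process on $\mathbb{R}^d$. The following are equivalent. (i) $\Pi$ is insertion-tolerant. (ii) For any $n\ge1$ and any Borel sets $S_1,\ldots,S_n\subseteq\mathbb{R}^d$ of positive finite Lebesgue measure, if $U_i$ is a uniformly random point in $S_i$ for each $i$, with $U_1,\ldots,U_n$ and $\Pi$ all independent, then $\Pi+\sum_{i=1}^n\delta_{U_i}\prec\Pi$. (iii) For any $n\ge 1$, if $(X_1,\ldots,X_n)$ is a random vector in $(\mathbb{R}^d)^n$ that admits a conditional law given $\Pi$ that is almost surely absolutely continuous with respect to Lebesgue measure, then $\Pi+\sum_{i=1}^n\delta_{X_i}\prec\Pi$.
   Context: Point processes are always simple and locally finite, i.e. random elements of the space $\mathbb{M}$ of simple locally finite point measures on $\mathbb{R}^d$, equipped with the $\sigma$-field generated by the evaluations $\mu\mapsto\mu(A)$, $A$ Borel. For random variables $X,Y$ with values in the same measurable space, $X\prec Y$ means that $\mathbb{P}(Y\in\mathcal{A})=0$ implies $\mathbb{P}(X\in\mathcal{A})=0$ for all measurable $\mathcal{A}$. For $x\in\mathbb{R}^d$, $\delta_x$ is the point measure at $x$. $\Pi$ is insertion-tolerant if for every Borel set $S\subseteq\mathbb{R}^d$ with Lebesgue measure in $(0,\infty)$, if $U$ is uniformly distributed on $S$ and independent of $\Pi$, then $\Pi+\delta_U\prec\Pi$. (The underlying probability space is extended if necessary to support such auxiliary random variables.) *)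

(* Defs.v *)
From HB Require Import structures.
From mathcomp Require Import all_boot all_order all_algebra.
From mathcomp Require Import all_classical all_reals all_analysis.
From mathcomp Require Import measurable_realfun.

Set Implicit Arguments.
Unset Strict Implicit.
Unset Printing Implicit Defensive.

Import Order.TTheory GRing.Theory Num.Theory.
Import numFieldNormedType.Exports.

Local Open Scope classical_set_scope.
Local Open Scope ring_scope.
Local Open Scope ereal_scope.

Lemma product_sigma_finite d1 d2 (T1 : measurableType d1)
    (T2 : measurableType d2) (R : realType)
    (m1 : {sigma_finite_measure set T1 -> \bar R})
    (m2 : {sigma_finite_measure set T2 -> \bar R}) :
  sigma_finite setT (m1 \x m2).
Proof.
have /sigma_finiteP[F [TF ndF Foo]] := sigma_finiteT m1.
have /sigma_finiteP[G [TG ndG Goo]] := sigma_finiteT m2.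
exists (fun n => F n `*` G n).
  rewrite -setXTT TF TG predeqE => -[x y]; split.
    move=> [/= [n _ Fnx] [k _ Gky]]; exists (maxn n k) => //; split.
    - by move: x Fnx; exact/subsetPset/ndF/leq_maxl.
    - by move: y Gky; exact/subsetPset/ndG/leq_maxr.
  by move=> [n _ []/= ? ?]; split; exists n.
move=> k; have [? ?] := Foo k; have [? ?] := Goo k.
split; first exact: measurableX.
by rewrite product_measure1E// lte_mul_pinfty// ge0_fin_numE.
Qed.

Section tuple_measure.
Context d (T : measurableType d) (R : realType).
Variable mu : {sigma_finite_measure set T -> \bar R}.

Definition tuple_cons n (p : T * n.-tuple T) : n.+1.-tuple T :=
  [tuple of p.1 :: p.2].

Lemma measurable_tuple_cons n :
  measurable_fun [set: T * n.-tuple T] (@tuple_cons n).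
Proof. exact: (measurable_cons measurable_fst measurable_snd). Qed.

Section step.
Variables (n : nat) (nu : {sigma_finite_measure set (n.-tuple T) -> \bar R}).

Definition tuple_step : set (n.+1.-tuple T) -> \bar R :=
  pushforward (mu \x nu) (@tuple_cons n).

Let tuple_step0 : tuple_step set0 = 0.
Proof. by rewrite /tuple_step /pushforward preimage_set0 measure0. Qed.

Let tuple_step_ge0 A : 0 <= tuple_step A.
Proof. by rewrite /tuple_step /pushforward measure_ge0. Qed.

Let tuple_step_sigma_additive : semi_sigma_additive tuple_step.
Proof.
move=> F mF tF mUF; rewrite /tuple_step /pushforward preimage_bigcup.
apply: measure_semi_sigma_additive.
- by move=> k; rewrite -[X in measurable X]setTI; exact: measurable_tuple_cons.
- apply/trivIsetP => /= i j _ _ ij; rewrite -preimage_setI.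
  by move/trivIsetP : tF => /(_ _ _ _ _ ij) ->//; rewrite preimage_set0.
- rewrite -preimage_bigcup -[X in measurable X]setTI.
  exact: measurable_tuple_cons.
Qed.

HB.instance Definition _ := isMeasure.Build _ _ _ tuple_step
  tuple_step0 tuple_step_ge0 tuple_step_sigma_additive.

Let tuple_step_sigma_finite : sigma_finite setT tuple_step.
Proof.
have [F TF Foo] := product_sigma_finite mu nu.
pose g (t : n.+1.-tuple T) := (thead t, [tuple of behead t]).
have mg : measurable_fun [set: n.+1.-tuple T] g.
  apply: measurable_fun_pair; last exact: measurable_behead.
  exact: measurable_tnth.
exists (fun k => g @^-1` F k); first by rewrite -preimage_bigcup -TF.
move=> k; have [mF Fk] := Foo k; split.
  by rewrite -[X in measurable X]setTI; exact: mg.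
rewrite /tuple_step /pushforward -comp_preimage (_ : g \o _ = id)//.
by apply/funext => -[x t]; rewrite /g /=; congr pair; exact/val_inj.
Qed.

HB.instance Definition _ := Measure_isSigmaFinite.Build _ _ _ tuple_step
  tuple_step_sigma_finite.
End step.

(* The n-fold product measure mu \x ... \x mu on n.-tuple T. *)
Fixpoint tuple_measure n : {sigma_finite_measure set (n.-tuple T) -> \bar R} :=
  if n is m.+1 then tuple_step (tuple_measure m) else \d_[tuple].

End tuple_measure.

(* R^n; its sigma-algebra, generated by the coordinate projections to the Borel
   line, is the Borel one. *)
Notation Rvec R n := (n.-tuple (measurableTypeR R)).

Definition lebesgue_tuple (R : realType) (n : nat) :
    {sigma_finite_measure set (Rvec R n) -> \bar R} :=
  tuple_measure (@lebesgue_measure R) n.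

Section measures.
Context d (T : measurableType d) (R : realType).

(* The space of all measures on T, with the sigma-algebra generated by the
   evaluations mu |-> mu A, A measurable. *)
Definition measures : Type := {measure set T -> \bar R}.

HB.instance Definition _ := gen_eqMixin measures.
HB.instance Definition _ := gen_choiceMixin measures.
HB.instance Definition _ := isPointed.Build measures mzero.

Definition measures_ev (A : set T) (mu : measures) : \bar R := mu A.

Definition measures_measurable : set (set measures) :=
  <<s \bigcup_(A in measurable)
        preimage_set_system [set: measures] (measures_ev A) measurable >>.

Let measures_measurable0 : measures_measurable set0.
Proof. exact: sigma_algebra0. Qed.

Let measures_measurableC A :
  measures_measurable A -> measures_measurable (~` A).
Proof. exact: sigma_algebraC. Qed.

Let measures_measurableU (F : (set measures)^nat) :
  (forall i, measures_measurable (F i)) ->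
  measures_measurable (\bigcup_i F i).
Proof. exact: sigma_algebra_bigcup. Qed.

Definition measures_display : measure_display.
Proof. by constructor. Qed.

HB.instance Definition _ := @isMeasurable.Build measures_display measures
  measures_measurable measures_measurable0 measures_measurableC
  measures_measurableU.

End measures.

Section add_points.
Context d (T : measurableType d) (R : realType).
Variables (mu : measures T R) (n : nat) (x : n.-tuple T).

Definition add_points_fun (A : set T) : \bar R :=
  mu A + \sum_(i < n) \d_(tnth x i) A.

Let add_points_funE : add_points_fun =
  measure_add mu (msum (fun i => \d_(nth point x i)) n).
Proof.
apply/funext => A; rewrite measure_addE /add_points_fun /msum.
by congr (_ + _); apply: eq_bigr => i _; rewrite (tnth_nth point).
Qed.

Let add_points0 : add_points_fun set0 = 0.
Proof. by rewrite add_points_funE /measure_add measure0. Qed.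

Let add_points_ge0 A : 0 <= add_points_fun A.
Proof. by rewrite add_points_funE /measure_add measure_ge0. Qed.

Let add_points_sigma_additive : semi_sigma_additive add_points_fun.
Proof.
by rewrite add_points_funE /measure_add; exact: measure_semi_sigma_additive.
Qed.

HB.instance Definition _ := isMeasure.Build _ _ _ add_points_fun
  add_points0 add_points_ge0 add_points_sigma_additive.

(* mu + \sum_i \delta_(x_i) *)
Definition add_points : measures T R := add_points_fun.

End add_points.

Section point_measures.
Context (R : realType) (d : nat).
Implicit Types mu : measures (Rvec R d) R.

Definition point_measure mu := exists (J : set nat) (x : nat -> Rvec R d),
  forall A, measurable A -> mu A = \esum_(j in J) \d_(x j) A.

Definition bounded_tuples (B : set (Rvec R d)) :=
  exists r : R, forall x, B x -> forall i, (`|tnth x i : R| <= r)%R.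

Definition locally_finite_measure mu :=
  forall B, measurable B -> bounded_tuples B -> mu B < +oo.

Definition simple_measure mu := forall x, mu [set x] <= 1.

Definition simple_lf_point_measure : set (measures (Rvec R d) R) :=
  [set mu | [/\ point_measure mu, locally_finite_measure mu &
                simple_measure mu]].

End point_measures.

Section probability_notions.
Context (R : realType).

(* X \prec Y.  A point inserted into a simple measure may fall on one of its
   atoms (with probability 0), so laws of point processes are compared in the
   space of all measures, whose sigma-algebra induces the evaluation
   sigma-algebra on simple_lf_point_measure. *)
Definition prec d d' (O : measurableType d) (T : measurableType d')
    (P : probability O R) (X Y : O -> T) :=
  forall A, measurable A -> P (Y @^-1` A) = 0 -> P (X @^-1` A) = 0.

(* (O', P') extends (O, P): random elements X of O become X \o phi on O'. *)
Definition extends d d' (O : measurableType d) (O' : measurableType d')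
    (P : probability O R) (P' : probability O' R) (phi : {mfun O' >-> O}) :=
  forall A, measurable A -> P' (phi @^-1` A) = P A.

Definition uniform_on d n (O : measurableType d) (P : probability O R)
    (S : set (Rvec R n)) (U : O -> Rvec R n) :=
  forall A, measurable A -> P (U @^-1` A) =
    ((fine (lebesgue_tuple R n (A `&` S)) / fine (lebesgue_tuple R n S))%R)%:E.

Definition generated_sigma d d' (O : measurableType d) (T : measurableType d')
    (X : O -> T) : set_system O := preimage_set_system setT X measurable.

Definition mutually_independent d (O : measurableType d)
    (P : probability O R) (I : finType) (F : I -> set_system O) :=
  forall (J : {set I}) (E : I -> set O), (forall i, i \in J -> F i (E i)) ->
    P (\bigcap_(i in [set i | i \in J]) E i) = \prod_(i in J) P (E i).

Definition independent2 d d1 d2 (O : measurableType d)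
    (T1 : measurableType d1) (T2 : measurableType d2) (P : probability O R)
    (X : O -> T1) (Y : O -> T2) :=
  forall A B, measurable A -> measurable B ->
    P (X @^-1` A `&` Y @^-1` B) = P (X @^-1` A) * P (Y @^-1` B).

(* kappa is a (regular) conditional law of X given Y. *)
Definition is_cond_law d d1 d2 (O : measurableType d)
    (T1 : measurableType d1) (T2 : measurableType d2) (P : probability O R)
    (X : O -> T1) (Y : O -> T2) (kappa : R.-pker T2 ~> T1) :=
  forall A B, measurable A -> measurable B ->
    P (X @^-1` A `&` Y @^-1` B) = \int[P]_(w in Y @^-1` B) kappa (Y w) A.

Definition insertion_tolerant disp (O : measurableType disp) (d : nat)
    (P : probability O R) (Pi : O -> measures (Rvec R d) R) :=
  forall S, measurable S -> 0 < lebesgue_tuple R d S < +oo ->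
  forall (disp' : measure_display) (O' : measurableType disp')
    (P' : probability O' R) (phi : {mfun O' >-> O}), extends P P' phi ->
  forall U : {mfun O' >-> Rvec R d},
    uniform_on P' S U -> independent2 P' U (Pi \o phi) ->
    prec P' (fun w => add_points (Pi (phi w)) [tuple U w]) (Pi \o phi).

End probability_notions.

(* Main.v *)
Require Import Defs.
From HB Require Import structures.
From mathcomp Require Import all_boot all_order all_algebra.
From mathcomp Require Import all_classical all_reals all_analysis.
From mathcomp Require Import measurable_realfun.

Set Implicit Arguments.
Unset Strict Implicit.
Unset Printing Implicit Defensive.

Import Order.TTheory GRing.Theory Num.Theory.
Import numFieldNormedType.Exports.

Local Open Scope classical_set_scope.
Local Open Scope ring_scope.
Local Open Scope ereal_scope.

(** All three conditions are compared with a single statement about the law of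
Pi.  Write mu for Lebesgue measure, call a set A of measures null if Pi almost
surely avoids it, and let [charged mu n A] be the set of measures m such that
m + sum_i delta_(x_i) lies in A for a set of (x_1, ..., x_n) of positive
mu^n-measure.  Say that Pi absorbs n points if [charged mu n A] is null whenever
A is.

Absorbing one point follows from insertion tolerance: the definition is tested
on the product of the original space with a uniform law on S, Fubini turns the
resulting null event into a statement about almost every configuration, and
sigma-finiteness of Lebesgue measure removes S
([insertion_tolerant_charged]).  Absorbing n points follows by iteration,
because Fubini gives
[charged mu n.+1 A = charged mu 1 (charged mu n A)] ([chargedS]): after one
absorbed point the configuration almost surely avoids the null set of those
that n further points can bring into A.  If the conditional law of X given Pi
is dominated by mu^n and A is null, then almost surely it gives no mass to the
x for which Pi + sum_i delta_(x_i) lies in A; integrating over the law of Pi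
gives (iii) ([prec_add_points]).

Conversely, (ii) is a special case of (iii): by uniqueness of measures on boxes,
independent uniform points are jointly independent of Pi, so that their joint
law is a constant conditional law, and this law has a density with respect to
mu^n ([mutually_independent_tuple], [uniform_product_dominated]).  Finally (i)
is (ii) for n = 1. *)

(** * Null sets of integrals and of product measures *)

Lemma measurable_preimageT d d' (T : measurableType d) (T' : measurableType d')
    (f : T -> T') (A : set T') :
  measurable_fun setT f -> measurable A -> measurable (f @^-1` A).
Proof. by move=> mf mA; rewrite -[X in measurable X]setTI; exact: mf. Qed.

Lemma ge0_integral_eq0P d (T : measurableType d) (R : realType)
    (mu : {measure set T -> \bar R}) (f : T -> \bar R) :
  measurable_fun setT f -> (forall x, 0 <= f x) ->
  \int[mu]_x f x = 0 <-> mu [set x | f x != 0] = 0.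
Proof.
move=> mf f0.
have mN : measurable [set x | f x != 0].
  by rewrite -[X in measurable X]setTI; exact: emeasurable_neq.
have -> : \int[mu]_x f x = \int[mu]_x `|f x|.
  by apply: eq_integral => x _; rewrite gee0_abs.
split=> [|N0].
  move/ae_eq_integral_abs => /(_ measurableT mf)[N [mN' N0 sN]].
  apply: subset_measure0 N0 => // x /= fx; apply: sN => /= /(_ I) fx0.
  by rewrite fx0 eqxx in fx.
apply/ae_eq_integral_abs => //; exists [set x | f x != 0]; split => //.
by move=> x /= /not_implyP[_ /eqP].
Qed.

(** Fubini for null sets; the form in which products of measures are used
throughout. *)
Lemma product_measure_eq0P d1 d2 (T1 : measurableType d1)
    (T2 : measurableType d2) (R : realType) (m1 : {measure set T1 -> \bar R})
    (m2 : {sigma_finite_measure set T2 -> \bar R}) (C : set (T1 * T2)) :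
  measurable C ->
  (m1 \x m2) C = 0 <-> m1 [set x | m2 (xsection C x) != 0] = 0.
Proof.
by move=> mC; apply: ge0_integral_eq0P => //; exact: measurable_fun_xsection.
Qed.

(** * Measures on tuples are determined by boxes *)

Section boxes.
Context d (T : measurableType d) (R : realType).

Definition box n (A : 'I_n -> set T) : set (n.-tuple T) :=
  [set t | forall i, A i (tnth t i)].

Definition boxes n : set (set (n.-tuple T)) :=
  [set box A | A in [set A | forall i, measurable (A i)]].

Lemma measurable_box n (A : 'I_n -> set T) :
  (forall i, measurable (A i)) -> measurable (box A).
Proof.
move=> mA.
rewrite (_ : box A = \bigcap_(i in [set: 'I_n]) (@tnth _ T ^~ i) @^-1` A i).
  apply: fin_bigcap_measurable => // i _.
  by apply: measurable_preimageT => //; exact: measurable_tnth.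
by apply/seteqP; split => [t At i _|t At i]; [exact: At|exact: At].
Qed.

Lemma measurable_tupleE n : @measurable _ (n.-tuple T) = <<s @boxes n >>.
Proof.
apply/seteqP; split; last first.
  apply: smallest_sub; first exact: sigma_algebra_measurable.
  by move=> _ [A mA <-]; exact: measurable_box.
apply: smallest_sub; first exact: smallest_sigma_algebra.
move=> C; rewrite -bigcup_seq => -[i _ [A mA <-]].
apply: sub_sigma_algebra; rewrite setTI.
(* a constraint on one coordinate is a box all of whose other sides are full *)
exists (fun j => if j == i then A else setT) => [j|]; first by case: ifP.
apply/seteqP; split => [t /(_ i)/=|t /= At j]; first by rewrite eqxx.
by case: ifPn => // /eqP ->.
Qed.

Lemma setI_closed_boxes n : setI_closed (@boxes n).
Proof.
move=> _ _ [A mA <-] [B mB <-]; exists (fun i => A i `&` B i).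
  by move=> i; exact: measurableI.
apply/seteqP; split => [t AB|t [At Bt] i]; last by split.
by split => i; have [] := AB i.
Qed.

(** Boxes form a pi-system that generates the sigma-algebra, so the uniqueness
theorem for finite measures applies. *)
Lemma eq_measure_boxes n (m1 m2 : {measure set (n.-tuple T) -> \bar R}) :
  m1 setT < +oo ->
  (forall A : 'I_n -> set T, (forall i, measurable (A i)) ->
    m1 (box A) = m2 (box A)) ->
  forall C, measurable C -> m1 C = m2 C.
Proof.
move=> m1oo m12 C mC; apply: (measure_unique (@boxes n) (fun=> setT)) => //.
- exact: measurable_tupleE.
- exact: setI_closed_boxes.
- move=> _; exists (fun=> setT) => //.
  by apply/seteqP; split.
- by rewrite bigcup_const.
- by move=> _ [A mA <-]; exact: m12.
Qed.

Lemma tuple_measure_box (mu : {sigma_finite_measure set T -> \bar R}) n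
    (A : 'I_n -> set T) : (forall i, measurable (A i)) ->
  tuple_measure mu n (box A) = \prod_(i < n) mu (A i).
Proof.
elim: n A => [|n IH] A mA.
  by rewrite big_ord0 /= diracE mem_set// => -[].
rewrite big_ord_recl -IH//= /tuple_step /pushforward.
rewrite (_ : _ @^-1` _ = A ord0 `*` box (fun i => A (lift ord0 i))); last first.
  apply/seteqP; split => [[x t] At|[x t] [/= Ax At] i].
    split => /=; first exact: (At ord0).
    by move=> i; have := At (lift ord0 i); rewrite tnthS.
  by case: (unliftP ord0 i) => [j|] ->; rewrite ?tnthS//; exact: At.
by rewrite product_measure1E//; apply: measurable_box.
Qed.

End boxes.

(** * Adding points is measurable and can be done one point at a time *)

Section add_points_theory.
Context d (T : measurableType d) (R : realType).
Local Notation M := (measures T R).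

Lemma measurable_fun_measuresP d' (O : measurableType d') (f : O -> M) :
  (forall A, measurable A -> measurable_fun setT (fun w => f w A)) ->
  measurable_fun setT f.
Proof.
move=> mf; apply: measurability; first by [].
move=> _ [_ [A mA [B mB <-]] <-].
by rewrite !setTI; exact: (measurable_preimageT (mf A mA) mB).
Qed.

Lemma measurable_measures_ev (A : set T) : measurable A ->
  measurable_fun setT (fun mu : M => mu A).
Proof.
move=> mA _ B mB; apply: sub_sigma_algebra.
by exists A => //; exists B.
Qed.

(** Joint measurability in the configuration and the points is what allows
Fubini to be applied to inserted points. *)
Lemma measurable_add_points n :
  measurable_fun [set: M * n.-tuple T] (fun p => add_points p.1 p.2).
Proof.
apply: measurable_fun_measuresP => A mA.
apply: emeasurable_funD.
  exact: (measurableT_comp (measurable_measures_ev mA)).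
apply: emeasurable_sum => i.
apply: (measurableT_comp (@measurable_fun_dirac _ T R setT A mA)).
exact: (measurableT_comp (measurable_tnth i)).
Qed.

Lemma add_points_cons (mu : M) n (x : T) (t : n.-tuple T) :
  add_points mu (tuple_cons (x, t)) = add_points (add_points mu [tuple x]) t.
Proof.
apply: eq_measure; apply/funext => A; rewrite /= /add_points_fun/=.
rewrite big_ord_recl addeA [in RHS]/add_points_fun big_ord1/=; congr (_ + _).
by apply: eq_bigr => i _; rewrite tnthS.
Qed.

End add_points_theory.

(** * Sets of configurations that inserted points can reach *)

Section insertion.
Context d (T : measurableType d) (R : realType).
Variable mu : {sigma_finite_measure set T -> \bar R}.
Local Notation M := (measures T R).

Definition insertions n (A : set M) (m : M) : set (n.-tuple T) :=
  [set x | A (add_points m x)].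
Arguments insertions n A m : clear implicits.

Let joint_insertions n (A : set M) :=
  (fun p : M * n.-tuple T => add_points p.1 p.2) @^-1` A.

Let measurable_joint_insertions n (A : set M) :
  measurable A -> measurable (@joint_insertions n A).
Proof.
move=> mA; exact: (measurable_preimageT (@measurable_add_points _ _ _ n) mA).
Qed.

Let insertionsE n (A : set M) (m : M) :
  insertions n A m = xsection (@joint_insertions n A) m.
Proof. by rewrite xsectionE. Qed.

Lemma measurable_insertions n (A : set M) (m : M) :
  measurable A -> measurable (insertions n A m).
Proof.
move=> mA; rewrite insertionsE; apply: measurable_xsection.
exact: measurable_joint_insertions.
Qed.

(** The configurations that enter A with positive probability when n points
with a law equivalent to mu^n are inserted. *)
Definition charged n (A : set M) : set M :=
  [set m | tuple_measure mu n (insertions n A m) != 0].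

Lemma measurable_charged n (A : set M) :
  measurable A -> measurable (charged n A).
Proof.
move=> mA; rewrite -[X in measurable X]setTI; apply: emeasurable_neq => //.
rewrite (_ : (fun m => _) =
    tuple_measure mu n \o xsection (@joint_insertions n A)).
  by apply: measurable_fun_xsection; exact: measurable_joint_insertions.
by apply/funext => m /=; rewrite insertionsE.
Qed.

Lemma charged1E (A : set M) : measurable A ->
  charged 1 A = [set m | mu [set x | A (add_points m [tuple x])] != 0].
Proof.
move=> mA; suff E m : tuple_measure mu 1 (insertions 1 A m) =
    mu [set x | A (add_points m [tuple x])].
  by apply/seteqP; split=> m; rewrite /charged /= E.
pose f (x : T) : 1.-tuple T := [tuple x].
have mf : measurable_fun setT f by exact: measurable_cons.
rewrite /= /tuple_step /pushforward/=.
(* mu^1 is mu times the unit mass at the empty tuple *)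
rewrite (_ : _ @^-1` _ = (f @^-1` insertions 1 A m) `*` setT); last first.
  apply/seteqP; split => [[x t]|[x t] []];
    by rewrite /= /f /tuple_cons (tuple0 t).
rewrite product_measure1E//.
  by rewrite /= diracT mule1.
by apply: measurable_preimageT => //; exact: measurable_insertions.
Qed.

(** Inserting n+1 points is inserting one point and then n others, and mu^(n+1)
is mu times mu^n: by Fubini, the (n+1)-tuples that lead into A have positive
measure iff a non-null set of first points leaves a non-null set of ways to
continue. *)
Lemma chargedS n (A : set M) : measurable A ->
  charged n.+1 A = charged 1 (charged n A).
Proof.
move=> mA; rewrite charged1E; last exact: measurable_charged.
have mC m : measurable (@tuple_cons _ T n @^-1` insertions n.+1 A m).
  apply: measurable_preimageT; first exact: measurable_tuple_cons.
  exact: measurable_insertions.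
suff E m : [set x | charged n A (add_points m [tuple x])] =
    [set x | tuple_measure mu n
       (xsection (@tuple_cons _ T n @^-1` insertions n.+1 A m) x) != 0].
  apply/seteqP; split=> m /=; rewrite /charged/= E /tuple_step /pushforward.
    by apply: contra_neq => /(product_measure_eq0P _ _ (mC m)).
  by apply: contra_neq => /(product_measure_eq0P _ _ (mC m)).
apply/funext => x; rewrite /charged /=.
suff -> : insertions n A (add_points m [tuple x]) =
    xsection (@tuple_cons _ T n @^-1` insertions n.+1 A m) x by [].
by rewrite xsectionE; apply/funext => t; rewrite /insertions /= add_points_cons.
Qed.

Variables (d' : measure_display) (O : measurableType d') (P : probability O R).
Variable Pi : {mfun O >-> M}.

Lemma charged_iter :
  (forall A, measurable A -> P (Pi @^-1` A) = 0 ->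
    P (Pi @^-1` charged 1 A) = 0) ->
  forall n A, measurable A -> P (Pi @^-1` A) = 0 ->
    P (Pi @^-1` charged n.+1 A) = 0.
Proof.
move=> H; elim=> [|n IH] A mA A0; first exact: H.
rewrite chargedS//; apply: H; first exact: measurable_charged.
exact: IH.
Qed.

End insertion.

Arguments insertions {d T R} n A m.
Arguments charged {d T R} mu n A.

(** * Null events under a conditional law *)

Section disintegration.
Context d d1 d2 (O : measurableType d) (T1 : measurableType d1)
  (T2 : measurableType d2) (R : realType) (P : probability O R).
Variables (X : {mfun O >-> T1}) (Y : {mfun O >-> T2}).
Variable kappa : R.-pker T2 ~> T1.

(** The joint law of (Y, X) when X is drawn from kappa given Y. *)
Definition joint_of_kernel (C : set (T2 * T1)) : \bar R :=
  \int[P]_w kappa (Y w) (xsection C (Y w)).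

Lemma measurable_joint_of_kernel C : measurable C ->
  measurable_fun setT (fun w => kappa (Y w) (xsection C (Y w))).
Proof.
move=> mC.
apply: (measurableT_comp (f := fun y => kappa y (xsection C y))) => //.
by apply: measurable_fun_xsection_finite_kernel; rewrite inE.
Qed.

Let joint0 : joint_of_kernel set0 = 0.
Proof. by apply: integral0_eq => w _; rewrite xsection0. Qed.

Let joint_ge0 C : 0 <= joint_of_kernel C.
Proof. exact: integral_ge0. Qed.

Let joint_sigma_additive : semi_sigma_additive joint_of_kernel.
Proof.
move=> F mF tF mUF.
rewrite [X in _ --> X](_ : _ = \sum_(n <oo) joint_of_kernel (F n)).
  by apply/cvg_closeP; split; [exact: is_cvg_nneseries|rewrite closeE].
rewrite -integral_nneseries//; last first.
  by move=> n; exact: measurable_joint_of_kernel.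
apply: eq_integral => w _; apply/esym/cvg_lim => //=; rewrite xsection_bigcup.
apply: (measure_sigma_additive _ (trivIset_xsection tF)) => ?.
exact: measurable_xsection.
Qed.

HB.instance Definition _ := isMeasure.Build _ _ _ joint_of_kernel
  joint0 joint_ge0 joint_sigma_additive.

(** The defining property of a conditional law is the case of rectangles, which
determine a finite measure on the product. *)
Lemma cond_law_joint : is_cond_law P X Y kappa ->
  forall C : set (T2 * T1), measurable C ->
  P [set w | C (Y w, X w)] = joint_of_kernel C.
Proof.
move=> XY C mC.
pose YX w := (Y w, X w).
have mYX : measurable_fun setT YX by exact: measurable_fun_pair.
pose mYX' := isMeasurableFun.Build _ _ _ _ _ mYX.
pose YXm : {mfun O >-> (T2 * T1)%type} := HB.pack YX mYX'.
pose C0 : set (set (T2 * T1)) :=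
  [set A `*` B | A in measurable & B in measurable].
apply: (measure_unique C0 (fun=> setT) _ _ _ _ (distribution P YXm)) => //.
- exact: measurable_prod_measurableType.
- move=> _ _ [A1 mA1 [A2 mA2 <-]] [B1 mB1 [B2 mB2 <-]].
  exists (A1 `&` B1); first exact: measurableI.
  by exists (A2 `&` B2); [exact: measurableI|rewrite setXI].
- by move=> _; exists setT => //; exists setT => //; rewrite setXTT.
- by rewrite bigcup_const.
- move=> _ [B mB [A mA <-]].
  rewrite [LHS](_ : _ = P (X @^-1` A `&` Y @^-1` B)); last first.
    by rewrite /distribution /pushforward setIC.
  rewrite XY// integral_mkcond; apply: eq_integral => w _.
  rewrite patchE; case: ifPn => YB.
    by rewrite in_xsectionX// mem_set//; exact: set_mem YB.
  by rewrite notin_xsectionX ?measure0.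
- by move=> _; rewrite (le_lt_trans (probability_le1 _ _))// ltry.
Qed.

Lemma cond_law_null (C : set (T2 * T1)) : is_cond_law P X Y kappa ->
  measurable C -> {ae P, forall w, kappa (Y w) (xsection C (Y w)) = 0} ->
  P [set w | C (Y w, X w)] = 0.
Proof.
move=> XY mC [N [mN N0 sN]]; rewrite cond_law_joint//.
apply/ge0_integral_eq0P => //; first exact: measurable_joint_of_kernel.
apply: subset_measure0 N0 => //.
  rewrite -[X in measurable X]setTI; apply: emeasurable_neq => //.
  exact: measurable_joint_of_kernel.
by move=> w /= /eqP kw; exact: sN.
Qed.

End disintegration.

Section cond_law_insertion.
Context d (T : measurableType d) (R : realType).
Variable mu : {sigma_finite_measure set T -> \bar R}.
Local Notation M := (measures T R).

(** Where the configuration Pi w is not charged, the n-tuples leading from it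
into A are mu^n-null, hence null for the conditional law as well. *)
Lemma prec_add_points d' (O : measurableType d') (P : probability O R)
    (Pi : {mfun O >-> M}) n (X : {mfun O >-> n.-tuple T})
    (kappa : R.-pker M ~> (n.-tuple T)) :
  (forall A, measurable A -> P (Pi @^-1` A) = 0 ->
    P (Pi @^-1` charged mu n A) = 0) ->
  is_cond_law P X Pi kappa ->
  {ae P, forall w, kappa (Pi w) `<< tuple_measure mu n} ->
  prec P (fun w => add_points (Pi w) (X w)) Pi.
Proof.
move=> H XPi [N [mN N0 sN]] A mA /(H _ mA) A0.
have mJ : measurable
    ((fun p : M * n.-tuple T => add_points p.1 p.2) @^-1` A).
  exact: (measurable_preimageT (@measurable_add_points _ _ _ n) mA).
rewrite [X in P X](_ : _ = [set w |
  ((fun p : M * n.-tuple T => add_points p.1 p.2) @^-1` A) (Pi w, X w)])//.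
apply: (cond_law_null XPi mJ).
have mC : measurable (Pi @^-1` charged mu n A).
  by apply: measurable_funPTI; exact: measurable_charged.
exists (N `|` Pi @^-1` charged mu n A); split.
- exact: measurableU.
- exact: null_set_setU.
- move=> w /= kw.
  have [/sN|] := pselect (~ kappa (Pi w) `<< tuple_measure mu n); first by left.
  move=> /contrapT/null_content_dominatesP kmu; right => /=.
  apply/eqP => mu0; apply: kw; rewrite xsectionE.
  by apply: kmu => //; exact: measurable_insertions.
Qed.

End cond_law_insertion.

(** * Insertion tolerance as absorption of one point *)

Section uniform.
Context d (T : measurableType d) (R : realType).
Variables (mu : {measure set T -> \bar R}) (S : set T) (mS : measurable S).

(** The default law \d_point is used only when S has measure 0 or +oo. *)
Definition uniform_law : probability T R := mnormalize (mrestr mu mS) \d_point.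

Lemma uniform_lawE (A : set T) : 0 < mu S < +oo ->
  uniform_law A = mu (A `&` S) * ((fine (mu S))^-1)%:E.
Proof.
move=> /andP[S0 Soo]; rewrite /uniform_law /= /mnormalize /=.
have -> : mrestr mu mS setT = mu S by rewrite /mrestr setTI.
by rewrite gt_eqF// lt_eqF.
Qed.

Lemma uniform_law_eq0 (A : set T) : 0 < mu S < +oo ->
  (uniform_law A == 0) = (mu (A `&` S) == 0).
Proof.
move=> S0; rewrite uniform_lawE// mule_eq0 [X in _ || X]gt_eqF ?orbF//.
by rewrite lte_fin invr_gt0 fine_gt0.
Qed.

End uniform.

(** The extension of the probability space that carries an independent random
element with a prescribed law. *)
Section product_extension.
Context d d' (O : measurableType d) (T : measurableType d') (R : realType).
Variables (P : probability O R) (Q : probability T R).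

HB.instance Definition _ := isMeasurableFun.Build _ _ (O * T)%type O fst
  (measurable_fst : measurable_fun setT (@fst O T)).
HB.instance Definition _ := isMeasurableFun.Build _ _ (O * T)%type T snd
  (measurable_snd : measurable_fun setT (@snd O T)).

Let PQ : probability (O * T)%type R := P \x Q.

Lemma product_extends : extends P PQ fst.
Proof.
move=> B mB; rewrite [LHS](_ : _ = PQ (B `*` setT)); last by rewrite setXT.
by rewrite [LHS]product_measure1E// [X in _ * X]probability_setT mule1.
Qed.

Lemma product_snd A : measurable A -> PQ (snd @^-1` A) = Q A.
Proof.
move=> mA; rewrite [LHS](_ : _ = PQ (setT `*` A)); last by rewrite setTX.
by rewrite [LHS]product_measure1E// [X in X * _]probability_setT mul1e.
Qed.

Lemma product_independent d'' (M : measurableType d'') (f : {mfun O >-> M}) :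
  independent2 PQ snd (f \o fst).
Proof.
move=> A B mA mB; have mfB : measurable (f @^-1` B) by exact: measurable_funPTI.
rewrite product_snd// comp_preimage product_extends// muleC.
rewrite -product_measure1E//; congr (PQ _).
by apply/seteqP; split=> [[w x] []|[w x] []].
Qed.

End product_extension.

Section one_point.
Context (R : realType) (n : nat) d (O : measurableType d) (P : probability O R).
Variable Pi : {mfun O >-> measures (Rvec R n) R}.
Local Notation L := (lebesgue_tuple R n).

Let insertion A w := [set x : Rvec R n | A (add_points (Pi w) [tuple x])].

Let measurable_joint_insertion A : measurable A ->
  measurable [set p : O * Rvec R n | insertion A p.1 p.2].
Proof.
move=> mA; pose f (p : O * Rvec R n) := (Pi p.1, [tuple p.2]).
apply: (@measurable_preimageT _ _ _ _
  ((fun p => add_points p.1 p.2) \o f)) => //.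
apply: (measurableT_comp (@measurable_add_points _ _ _ 1)).
by apply: measurable_fun_pair; [exact: measurableT_comp|exact: measurable_cons].
Qed.

Let measurable_insertion A w : measurable A -> measurable (insertion A w).
Proof.
move=> mA; have := measurable_xsection w (measurable_joint_insertion mA).
by rewrite xsectionE.
Qed.

(** Insertion tolerance is tested on the product of the original space with the
uniform law on S, whose null sets are those of Lebesgue measure restricted to
S. *)
Lemma insertion_tolerant_uniform S A : insertion_tolerant P Pi ->
  measurable S -> L S < +oo -> measurable A -> P (Pi @^-1` A) = 0 ->
  P [set w | L (insertion A w `&` S) != 0] = 0.
Proof.
move=> H mS Soo mA A0; have [S0|S0] := eqVneq (L S) 0.
  rewrite [X in P X](_ : _ = set0) ?measure0//.
  apply/seteqP; split=> // w /= /negP; apply; apply/eqP.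
  apply: subset_measure0 S0 => //; apply: measurableI => //.
  exact: measurable_insertion.
have {}S0 : 0 < L S < +oo by rewrite lt0e S0 measure_ge0.
pose Q := uniform_law L mS.
have unifU : uniform_on ((P \x Q) : probability _ R) S snd.
  move=> C mC; rewrite product_snd// /Q uniform_lawE// EFinM fineK//.
  rewrite ge0_fin_numE// (le_lt_trans _ Soo)// le_measure ?inE//.
  exact: measurableI.
have := H _ mS S0 _ _ _ fst (product_extends P Q) _ unifU
  (product_independent P Q Pi) _ mA.
rewrite comp_preimage (product_extends P Q); last exact: measurable_funPTI.
move=> /(_ A0) /(product_measure_eq0P _ _ (measurable_joint_insertion mA)).
suff -> : [set w | L (insertion A w `&` S) != 0] = [set w | Q
    (xsection [set p : O * Rvec R n | insertion A p.1 p.2] w) != 0] by [].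
by apply/funext => w /=; rewrite xsectionE /Q uniform_law_eq0.
Qed.

(** Countably many sets of finite measure cover the space, and a set that meets
each of them in a null set is null. *)
Lemma insertion_tolerant_charged : insertion_tolerant P Pi ->
  forall A, measurable A -> P (Pi @^-1` A) = 0 ->
  P (Pi @^-1` charged L 1 A) = 0.
Proof.
move=> H A mA A0; have [F FT mF] := sigma_finiteT L.
apply/negligibleP; first by apply: measurable_funPTI; exact: measurable_charged.
rewrite charged1E//.
apply: (@negligibleS _ _ _ _
    (\bigcup_k [set w | L (insertion A w `&` F k) != 0])) => [w|]; last first.
  apply: negligible_bigcup => k; have [mFk Fkoo] := mF k.
  apply/negligibleP; last exact: insertion_tolerant_uniform.
  have mJ := measurableI _ _ (measurable_joint_insertion mA)
    (measurable_preimageT measurable_snd mFk).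
  rewrite -[X in measurable X]setTI; apply: emeasurable_neq => //.
  apply: eq_measurable_fun (measurable_fun_xsection L mJ) => w _ /=.
  by rewrite xsectionE.
rewrite /= -/(insertion A w) => w0; apply: contrapT => wF.
have mAF k : measurable (insertion A w `&` F k).
  by apply: measurableI; [exact: measurable_insertion|case: (mF k)].
move/eqP: w0; apply; rewrite -(setIT (insertion A w)) FT setI_bigcupr.
apply/negligibleP; first exact: bigcup_measurable.
apply: negligible_bigcup => k; apply/negligibleP => //.
by apply: contrapT => /eqP wk; apply: wF; exists k.
Qed.

End one_point.

(** * Independent uniform points have a dominated conditional law *)

Section independence.
Context d (O : measurableType d) (R : realType) (P : probability O R).

Lemma prode_option (I : finType) (F : option I -> \bar R) :
  \prod_o F o = F None * \prod_i F (Some i).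
Proof.
rewrite (bigD1 None)//= (reindex_omap Some id) => [|[]//]; congr (_ * _).
by apply: eq_bigl => i; rewrite eqxx.
Qed.

Lemma bigcap_option (I : finType) (E : option I -> set O) :
  \bigcap_(o in [set: option I]) E o =
  \bigcap_(i in [set: I]) E (Some i) `&` E None.
Proof.
apply/seteqP; split=> [w Ew|w [Ew1 Ew2]].
  by split=> [i _|]; exact: Ew.
by case=> [i|] _ //; exact: Ew1.
Qed.

(** Only the full index set has to be checked: an event that is left out of a
subfamily can be replaced by the sure event. *)
Lemma mutually_independentP (I : finType) (F : I -> set_system O) :
  (forall i, F i setT) ->
  (forall E, (forall i, F i (E i)) ->
    P (\bigcap_(i in [set: I]) E i) = \prod_i P (E i)) ->
  mutually_independent P F.
Proof.
move=> FT indF J E FE.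
pose E' i := if i \in J then E i else setT.
have -> : \bigcap_(i in [set i | i \in J]) E i = \bigcap_(i in [set: I]) E' i.
  rewrite /E'; apply/seteqP; split=> [w Ew i _|w Ew i /= iJ].
    by case: ifPn => // iJ; exact: Ew.
  by have := Ew i Logic.I; rewrite iJ.
rewrite indF.
  rewrite [RHS]big_mkcond/=; apply: eq_bigr => i _; rewrite /E'.
  by case: ifP => // _; rewrite probability_setT.
by move=> i; rewrite /E'; case: ifPn => // iJ; exact: FE.
Qed.

Context d1 d2 (T : measurableType d1) (M : measurableType d2).

Lemma independent2_mutually (U : {mfun O >-> T}) (Y : {mfun O >-> M}) :
  independent2 P U Y ->
  mutually_independent P (fun o : option 'I_1 =>
    if o is Some _ then generated_sigma U else generated_sigma Y).
Proof.
move=> UY; apply: mutually_independentP => [[i|]|E FE].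
- by exists setT => //; rewrite preimage_setT setTI.
- by exists setT => //; rewrite preimage_setT setTI.
have [A mA UA] := FE (Some ord0); have [B mB YB] := FE None.
rewrite prode_option bigcap_option big_ord1 -UA -YB !setTI muleC -UY//.
congr (P (_ `&` _)); rewrite -[U @^-1` A]setTI UA.
apply/seteqP; split=> [w|w Ew i _]; first exact.
by rewrite (ord1 i).
Qed.

Section tuple.
Variables (n : nat) (U : 'I_n -> {mfun O >-> T}) (Y : {mfun O >-> M}).
Hypothesis indUY : mutually_independent P (fun o : option 'I_n =>
  if o is Some i then generated_sigma (U i) else generated_sigma Y).

Let UT w := [tuple U i w | i < n].

Let measurable_UT : measurable_fun setT UT.
Proof.
apply/measurable_fun_tnthP => i; rewrite (_ : _ \o _ = U i)//.
by apply/funext => w; rewrite /= tnth_mktuple.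
Qed.

HB.instance Definition _ := isMeasurableFun.Build _ _ _ _ UT measurable_UT.

Definition mfun_tuple : {mfun O >-> n.-tuple T} := UT.

Lemma mutually_independent_box (A : 'I_n -> set T) B :
  (forall i, measurable (A i)) -> measurable B ->
  P (mfun_tuple @^-1` box A `&` Y @^-1` B) =
  \prod_i P (U i @^-1` A i) * P (Y @^-1` B).
Proof.
move=> mA mB.
pose E (o : option 'I_n) := if o is Some i then U i @^-1` A i else Y @^-1` B.
have := @indUY [set: option 'I_n]%SET E.
rewrite (_ : [set i | i \in [set: option 'I_n]%SET] = [set: option 'I_n]);
  last first.
  by apply/seteqP; split=> // o _; rewrite /= finset.in_setT.
rewrite bigcap_option.
under eq_bigl do rewrite finset.in_setT.
rewrite prode_option muleC => <-.
  congr (P (_ `&` _)); apply/seteqP; split=> [w Aw i _|w Aw i] /=.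
    by have := Aw i; rewrite tnth_mktuple.
  by rewrite tnth_mktuple; exact: Aw.
by case=> [i|] _; [exists (A i)|exists B]; rewrite ?setTI.
Qed.

Lemma mutually_independent_law_box (A : 'I_n -> set T) :
  (forall i, measurable (A i)) ->
  P (mfun_tuple @^-1` box A) = \prod_i P (U i @^-1` A i).
Proof.
move=> mA; have := mutually_independent_box mA measurableT.
by rewrite preimage_setT setIT probability_setT mule1.
Qed.

(** For a fixed event Y in B, both sides of the product rule are finite measures
in the set of values of the tuple, and mutual independence makes them agree on
boxes. *)
Lemma mutually_independent_tuple : independent2 P mfun_tuple Y.
Proof.
move=> C B mC mB; have mYB : measurable (Y @^-1` B) by exact: measurable_funPTI.
have YBfin : P (Y @^-1` B) \is a fin_num by exact: fin_num_measure.
have c0 : (0 <= fine (P (Y @^-1` B)))%R by rewrite fine_ge0.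
pose m1 : {measure set O -> \bar R} := mrestr P mYB.
have -> : P (mfun_tuple @^-1` C `&` Y @^-1` B) =
  pushforward m1 mfun_tuple C by [].
rewrite muleC -(fineK YBfin).
have -> : (fine (P (Y @^-1` B)))%:E * P (mfun_tuple @^-1` C) =
  mscale (NngNum c0) (distribution P mfun_tuple) C by [].
apply: eq_measure_boxes => //.
  rewrite /= /pushforward /mrestr preimage_setT setTI.
  by rewrite ltey_eq YBfin.
move=> A mA; rewrite [LHS]mutually_independent_box//.
by rewrite -mutually_independent_law_box// muleC -[in LHS](fineK YBfin).
Qed.

End tuple.

End independence.

(** The hypothesis says that nu agrees on boxes with the normalized restriction
of mu^n to the box with sides S i; hence it is that restriction. *)
Lemma uniform_product_dominated d (T : measurableType d) (R : realType)
    (mu : {sigma_finite_measure set T -> \bar R}) n (S : 'I_n -> set T)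
    (nu : {measure set (n.-tuple T) -> \bar R}) :
  (forall i, measurable (S i)) -> (forall i, 0 < mu (S i) < +oo) ->
  (forall A : 'I_n -> set T, (forall i, measurable (A i)) ->
    nu (box A) = \prod_i (fine (mu (A i `&` S i)) / fine (mu (S i)))%:E) ->
  nu `<< tuple_measure mu n.
Proof.
move=> mS S0 nuE.
have c0 : (0 <= \prod_i (fine (mu (S i)))^-1)%R.
  by apply: prodr_ge0 => i _; rewrite invr_ge0 fine_ge0.
have mB := measurable_box mS.
pose m2 : {measure set (n.-tuple T) -> \bar R} :=
  mscale (NngNum c0) (mrestr (tuple_measure mu n) mB).
have m2E C : m2 C = (\prod_i (fine (mu (S i)))^-1)%:E *
    tuple_measure mu n (C `&` box S) by [].
have nu_m2 C : measurable C -> nu C = m2 C.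
  apply: (eq_measure_boxes (m2 := m2)).
    have -> : setT = @box _ T n (fun=> setT) by apply/seteqP; split.
    by rewrite nuE// prodEFin ltry.
  move=> A mA; rewrite nuE// m2E.
  have -> : box A `&` box S = box (fun i => A i `&` S i).
    by apply/seteqP; split=> [t [At St] i//|t AS]; split=> i; have [] := AS i.
  have mAS i : measurable (A i `&` S i) by exact: measurableI.
  rewrite tuple_measure_box// prodEFin.
  under [X in _ * X]eq_bigr => i _.
    rewrite -[mu _]fineK.
      over.
    have /andP[_ Soo] := S0 i.
    by rewrite ge0_fin_numE// (le_lt_trans _ Soo)// le_measure ?inE.
  by rewrite prodEFin -EFinM big_split/= mulrC.
apply/null_content_dominatesP => C mC C0.
rewrite nu_m2// m2E (_ : tuple_measure _ _ _ = 0) ?mule0//.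
by apply: subset_measure0 C0 => //; exact: measurableI.
Qed.

Section constant_kernel.
Context d d1 d2 (O : measurableType d) (T1 : measurableType d1)
  (T2 : measurableType d2) (R : realType) (P : probability O R).
Variables (X : {mfun O >-> T1}) (Y : {mfun O >-> T2}).

Let law : pprobability T1 R := distribution P X.

(** Under independence the conditional law of X is constantly the law of X. *)
Definition law_kernel : R.-pker T2 ~> T1 :=
  kprobability (measurable_cst law : measurable_fun [set: T2] (cst law)).

Lemma law_kernelE y : law_kernel y = distribution P X.
Proof. by []. Qed.

Lemma independent_cond_law :
  independent2 P X Y -> is_cond_law P X Y law_kernel.
Proof.
move=> XY A B mA mB; rewrite XY// integral_cst//.
exact: measurable_funPTI.
Qed.

End constant_kernel.

(** * The equivalence *)

Section implications.
Context (R : realType) (d : nat) (disp : measure_display).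
Context (O : measurableType disp) (P : probability O R).
Variable Pi : {mfun O >-> measures (Rvec R d) R}.
Local Notation L := (lebesgue_tuple R d).

Definition uniform_insertion := forall n : nat, (0 < n)%N ->
  forall S : 'I_n -> set (Rvec R d),
    (forall i, measurable (S i)) ->
    (forall i, 0 < L (S i) < +oo) ->
  forall (disp' : measure_display) (O' : measurableType disp')
    (P' : probability O' R) (phi : {mfun O' >-> O}), extends P P' phi ->
  forall U : 'I_n -> {mfun O' >-> Rvec R d},
    (forall i, uniform_on P' (S i) (U i)) ->
    mutually_independent P' (fun o : option 'I_n =>
      if o is Some i then generated_sigma (U i)
      else generated_sigma (Pi \o phi)) ->
    prec P' (fun w => add_points (Pi (phi w)) [tuple U i w | i < n])
      (Pi \o phi).

Definition dominated_insertion := forall n : nat, (0 < n)%N ->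
  forall (disp' : measure_display) (O' : measurableType disp')
    (P' : probability O' R) (phi : {mfun O' >-> O}), extends P P' phi ->
  forall X : {mfun O' >-> n.-tuple (Rvec R d)},
    (exists kappa : R.-pker (measures (Rvec R d) R) ~>
                      (n.-tuple (Rvec R d)),
      is_cond_law P' X (Pi \o phi) kappa /\
      {ae P', forall w,
        kappa (Pi (phi w)) `<< tuple_measure L n}) ->
    prec P' (fun w => add_points (Pi (phi w)) (X w)) (Pi \o phi).

Lemma insertion_tolerant_dominated :
  insertion_tolerant P Pi -> dominated_insertion.
Proof.
move=> tol [//|n] _ disp' O' P' phi P'phi X [kappa [condX domX]].
apply: (prec_add_points (Pi := Pi \o phi) _ condX domX) => A mA.
have mC := measurable_charged L n.+1 mA.
have lawE B : measurable B -> P' ((Pi \o phi) @^-1` B) = P (Pi @^-1` B).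
  by move=> mB; apply: P'phi; exact: measurable_funPTI.
rewrite !lawE//; apply: charged_iter => //.
exact: insertion_tolerant_charged.
Qed.

Lemma dominated_uniform_insertion : dominated_insertion -> uniform_insertion.
Proof.
move=> dom n n0 S mS S0 disp' O' P' phi P'phi U unifU indU.
pose Y : {mfun O' >-> measures (Rvec R d) R} := Pi \o phi.
pose X := mfun_tuple U.
apply: (dom n n0 _ _ _ _ P'phi X).
exists (law_kernel _ P' X); split.
  by apply: independent_cond_law; exact: (mutually_independent_tuple (Y := Y)).
apply: aeW => w; rewrite law_kernelE.
apply: (@uniform_product_dominated _ _ _ _ _ S) => // A mA.
rewrite [LHS](mutually_independent_law_box (Y := Y))//.
by apply: eq_bigr => i _; rewrite unifU.
Qed.

Lemma uniform_insertion_tolerant : uniform_insertion -> insertion_tolerant P Pi.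
Proof.
move=> unif S mS S0 disp' O' P' phi P'phi U unifU indU.
rewrite (_ : (fun w => _) =
    (fun w => add_points (Pi (phi w)) [tuple U w | i < 1])).
  apply: (unif 1%N isT (fun=> S) _ _ _ _ P' phi P'phi (fun=> U)) => //.
  exact: (independent2_mutually (Y := Pi \o phi)).
apply/funext => w; congr add_points; apply: eq_from_tnth => i.
by rewrite tnth_mktuple (ord1 i).
Qed.

End implications.

Theorem theorem2 (R : realType) (d : nat) (d_gt0 : (0 < d)%N)
    (disp : measure_display) (O : measurableType disp) (P : probability O R)
    (Pi : {mfun O >-> measures (Rvec R d) R})
    (Pi_simple_lf : forall w, simple_lf_point_measure (Pi w)) :
  [<->
    insertion_tolerant P Pi;

    forall n : nat, (0 < n)%N ->
    forall S : 'I_n -> set (Rvec R d),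
      (forall i, measurable (S i)) ->
      (forall i, 0 < lebesgue_tuple R d (S i) < +oo) ->
    forall (disp' : measure_display) (O' : measurableType disp')
      (P' : probability O' R) (phi : {mfun O' >-> O}), extends P P' phi ->
    forall U : 'I_n -> {mfun O' >-> Rvec R d},
      (forall i, uniform_on P' (S i) (U i)) ->
      mutually_independent P' (fun o : option 'I_n =>
        if o is Some i then generated_sigma (U i)
        else generated_sigma (Pi \o phi)) ->
      prec P' (fun w => add_points (Pi (phi w)) [tuple U i w | i < n])
        (Pi \o phi);

    forall n : nat, (0 < n)%N ->
    forall (disp' : measure_display) (O' : measurableType disp')
      (P' : probability O' R) (phi : {mfun O' >-> O}), extends P P' phi ->
    forall X : {mfun O' >-> n.-tuple (Rvec R d)},
      (exists kappa : R.-pker (measures (Rvec R d) R) ~>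
                        (n.-tuple (Rvec R d)),
        is_cond_law P' X (Pi \o phi) kappa /\
        {ae P', forall w,
          kappa (Pi (phi w)) `<< tuple_measure (lebesgue_tuple R d) n}) ->
      prec P' (fun w => add_points (Pi (phi w)) (X w)) (Pi \o phi)].
Proof.
have i_iii := @insertion_tolerant_dominated R d disp O P Pi.
have iii_ii := @dominated_uniform_insertion R d disp O P Pi.
have ii_i := @uniform_insertion_tolerant R d disp O P Pi.
tfae.
- by move=> /i_iii/iii_ii.
- by move=> /ii_i/i_iii.
- by move=> /iii_ii/ii_i.
Qed.
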